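(* For all non-negative integers $n$ and $m$, $$q^{n-m}\cdot S_q[n,m]=\sum_{k=m}^{n}(-1)^{n-k}\binom{n}{k}\, S_q[k+1,m+1].$$
   Context: For a positive integer $k$ let $[k]_q=1+q+\cdots+q^{k-1}$, and $[0]_q=0$. The $q$-Stirling numbers of the second kind $S_q[n,k]$ ($n,k\ge 0$) are polynomials in $q$ defined by $S_q[n,0]=\delta_{n,0}$, $S_q[0,k]=\delta_{0,k}$ and $S_q[n,k]=S_q[n-1,k-1]+[k]_q\, S_q[n-1,k]$ for $n,k\ge 1$. Equivalently, a word $w=w_1\cdots w_n$ of positive integers is a restricted growth word ($RG$-word) if $w_i\le \max(0,w_1,\dots,w_{i-1})+1$ for all $i$; if $RG(n,k)$ denotes the set of $RG$-words of length $n$ with maximal entry $k$ (with $RG(0,0)$ consisting of the empty word), then $S_q[n,k]=\sum_{w\in RG(n,k)} q^{\sum_{i=1}^n (w_i-1)-\binom{k}{2}}$. In particular $S_q[n,k]=0$ when $k>n$. *)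

(* Defs.v *)
From mathcomp Require Import all_boot all_order all_algebra.

Set Implicit Arguments.
Unset Strict Implicit.
Unset Printing Implicit Defensive.

Import GRing.Theory.
Local Open Scope ring_scope.

(* Everything lives in Z[q]: the indeterminate 'X of {poly int} plays the
   role of q. *)

Definition qint (k : nat) : {poly int} := \sum_(i < k) 'X^i.

Fixpoint qstirling2 (n k : nat) : {poly int} :=
  match n, k with
  | 0, 0 => 1
  | 0, _.+1 => 0
  | _.+1, 0 => 0
  | n'.+1, k'.+1 => qstirling2 n' k' + qint k'.+1 * qstirling2 n' k'.+1
  end.

(* Justifies writing the factor q^(n-m) in front of S_q[n,m] with truncated
   subtraction: whenever the exponent n - m is negative, S_q[n,m] vanishes. *)
Lemma qstirling2_small (n m : nat) : (n < m)%N -> qstirling2 n m = 0.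
Proof.
elim: n m => [|n IHn] [|m] //= lt_nm.
by rewrite !IHn ?mulr0 ?addr0 // ltnW.
Qed.

(* Main.v *)
(** The right-hand side is the [n]-th forward difference at [0] of
    [f_m k = S_q[k+1, m+1]]. Since [[m+1]_q - 1 = q [m]_q], the recurrence of
    [S_q] gives [f_m (k+1) - f_m k = f_(m-1) k + q [m]_q f_m k], so that these
    differences obey the same recurrence in [n] as [q^(n-m) S_q[n, m]]. *)
Require Import Defs.
From mathcomp Require Import all_boot all_order all_algebra.
From mathcomp Require Import ring.

Import GRing.Theory.
Local Open Scope ring_scope.

(** The closed form of the [n]-th forward difference of [f] at 0. The truncated [n - k] is exact
    since [k <= n]. *)
Definition binomial_diff {R : comPzRingType} (n : nat) (f : nat -> R) : R :=
  \sum_(k < n.+1) (-1) ^+ (n - k) * ('C(n, k))%:R * f k.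

Lemma eq_binomial_diff (R : comPzRingType) n (f g : nat -> R) :
  f =1 g -> binomial_diff n f = binomial_diff n g.
Proof. by move=> fg; apply: eq_bigr => k _; rewrite fg. Qed.

Lemma binomial_diff0 (R : comPzRingType) (f : nat -> R) :
  binomial_diff 0 f = f 0%N.
Proof. by rewrite /binomial_diff big_ord1 bin0 !mul1r. Qed.

Lemma binomial_diff_linear (R : comPzRingType) n (a : R) (f g : nat -> R) :
  binomial_diff n (fun k => f k + a * g k) =
  binomial_diff n f + a * binomial_diff n g.
Proof.
rewrite /binomial_diff mulr_sumr -big_split /=.
by apply: eq_bigr => k _; rewrite mulrDr mulrCA.
Qed.

(** Pascal's rule, applied to the coefficient of each [f k.+1]. *)
Lemma binomial_diffS (R : comPzRingType) n (f : nat -> R) :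
  binomial_diff n.+1 f = binomial_diff n (fun k => f k.+1 - f k).
Proof.
have -> : binomial_diff n (fun k => f k.+1 - f k) =
          binomial_diff n (fun k => f k.+1) - binomial_diff n f.
  rewrite -mulN1r -binomial_diff_linear; apply: eq_binomial_diff => k.
  by rewrite mulN1r.
(* Isolate [f 0] and shift the index, which flips the sign. The extra top term [k = n] carries
   ['C(n, n.+1) = 0] and aligns this range with that of the other sum. *)
have -> : binomial_diff n f = (-1) ^+ n * f 0%N -
    \sum_(k < n.+1) (-1) ^+ (n - k) * ('C(n, k.+1))%:R * f k.+1.
  rewrite big_ord_recr /= bin_small // mulr0 mul0r addr0.
  rewrite /binomial_diff big_ord_recl /= subn0 bin0 mulr1 -sumrN.
  congr (_ + _); apply: eq_bigr => k _.
  by rewrite /bump add1n -[in RHS](subnSK (ltn_ord k)) exprS !mulN1r !mulNr opprK.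
rewrite /binomial_diff big_ord_recl /= subn0 bin0 mulr1 exprS mulN1r mulNr.
rewrite opprB addrA -big_split [LHS]addrC /=; congr (_ - _).
apply: eq_bigr => k _.
by rewrite /bump add1n subSS binS natrD mulrDr mulrDl addrC.
Qed.

Lemma qintS k : qint k.+1 = 1 + 'X * qint k.
Proof.
rewrite /qint big_ord_recl expr0 mulr_sumr; congr (_ + _).
by apply: eq_bigr => i _; rewrite lift0 exprS.
Qed.

Lemma qstirling2SS n m :
  qstirling2 n.+1 m.+1 = qstirling2 n m + qint m.+1 * qstirling2 n m.+1.
Proof. by []. Qed.

(** Makes [f_0] constant, so that its differences of positive order vanish. *)
Lemma qstirling2_1 n : qstirling2 n.+1 1 = 1.
Proof.
elim: n => [|n IHn]; first by rewrite /= mulr0 addr0.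
by rewrite qstirling2SS IHn /= add0r mulr1 /qint big_ord1 expr0.
Qed.

Lemma Xexp_qstirling2SS n m :
  'X^(n.+1 - m.+1) * qstirling2 n.+1 m.+1 =
  'X^(n - m) * qstirling2 n m +
  'X * qint m.+1 * ('X^(n - m.+1) * qstirling2 n m.+1).
Proof.
rewrite subSS qstirling2SS mulrDr; congr (_ + _).
(* For [m < n] one factor ['X] leaves the power; otherwise the exponent is truncated, but
   [qstirling2 n m.+1] is zero. *)
have [lt_mn | le_nm] := ltnP m n; first by rewrite -(subnSK lt_mn) exprS; ring.
by rewrite qstirling2_small ?ltnS // !mulr0.
Qed.

Lemma binomial_diff_qstirling2 n m :
  binomial_diff n (fun k => qstirling2 k.+1 m.+1) =
  'X^(n - m) * qstirling2 n m.
Proof.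
elim: n m => [|n IHn] m.
  rewrite binomial_diff0 sub0n mul1r.
  by case: m => [|m]; [apply: qstirling2_1 | rewrite qstirling2_small].
rewrite binomial_diffS; case: m => [|m].
  rewrite mulr0 /binomial_diff big1 // => k _.
  by rewrite !qstirling2_1 subrr mulr0.
(* The induction hypothesis, at [m] and at [m.+1], turns both terms into differences of order [n],
   which linearity merges; it remains to compare the functions pointwise. *)
rewrite Xexp_qstirling2SS -!IHn -binomial_diff_linear.
apply: eq_binomial_diff => k; rewrite qstirling2SS (qintS m.+1); ring.
Qed.

Theorem theorem3p2 (n m : nat) :
  'X^(n - m) * qstirling2 n m =
  \sum_(m <= k < n.+1)
     (-1) ^+ (n - k) * ('C(n, k))%:R * qstirling2 k.+1 m.+1.
Proof.
rewrite -binomial_diff_qstirling2 /binomial_diff.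
rewrite -(big_mkord xpredT
  (fun k => (-1) ^+ (n - k) * ('C(n, k))%:R * qstirling2 k.+1 m.+1)).
have small_terms p : (p <= m)%N ->
    \sum_(0 <= k < p)
      (-1) ^+ (n - k) * ('C(n, k))%:R * qstirling2 k.+1 m.+1 = 0.
  move=> le_pm; rewrite big_nat big1 // => k /andP[_ lt_kp].
  by rewrite qstirling2_small ?mulr0 // ltnS (leq_trans lt_kp).
(* Either the full range splits at [m], or [m] exceeds [n.+1]: then the sum from [m] is empty and
   all terms of the full sum vanish. *)
have [le_mn | lt_nm] := leqP m n.+1.
  by rewrite (big_cat_nat _ le_mn) //= small_terms // add0r.
by rewrite small_terms ?(ltnW lt_nm) // big_geq // ltnW.
Qed.
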